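(* Let $q$ be a prime power, $m,r\ge1$, $V_{m,r}=\{f\in\mathbb{F}_q[x_1,\ldots,x_m]:\deg f\le r\}$, and let $V$ be an $\mathbb{F}_q$-subspace of $V_{m,r}$ that has property $( * )$. Then for every $\mathcal{L}\subseteq V$, $$q^{m-1}|\mathcal{L}|^2\le\sum_{f,f'\in\mathcal{L}}\operatorname{N}_q(f-f')\le q^{m-1}|\mathcal{L}|^2+q^{\dim V-1}|\mathcal{L}|,$$ where the sum is over all ordered pairs $(f,f')\in\mathcal{L}\times\mathcal{L}$.
   Context: For $g\in\mathbb{F}_q[x_1,\ldots,x_m]$, $\operatorname{N}_q(g)=|\{\alpha\in\mathbb{F}_q^m:g(\alpha)=0\}|$. A subspace $V$ of $\mathbb{F}_q[x_1,\ldots,x_m]$ has property $( * )$ if $V$ has a basis of monomials $\{x_1^{i_1}\cdots x_m^{i_m}:(i_1,\ldots,i_m)\in\mathcal{I}\}$, where $\mathcal{I}$ is a finite subset of $\mathbb{N}^m$ such that (i) $(0,\ldots,0)\in\mathcal{I}$, and (ii) there exist integers $k_1,\ldots,k_m$ with $(k_1,0,\ldots,0),\ldots,(0,\ldots,0,k_m)\in\mathcal{I}$ and $\gcd(k_i,q-1)=1$ for each $i$.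
   Formalization: In property ( * )(ii) the integers k_i are required to be positive; this is automatic for q > 2, but for q = 2 allowing k_i = 0 makes the claim false (V the constants, m = 2, L = {0} gives 4 ≤ 3). *)

(* Defs.v *)
From HB Require Import structures.
From mathcomp Require Import all_boot all_order all_algebra finmap.
From mathcomp.multinomials Require Import mpoly.

Set Implicit Arguments.
Unset Strict Implicit.
Unset Printing Implicit Defensive.

Import GRing.Theory.

Local Open Scope ring_scope.

Section BoundedDegree.

Variables (m r : nat) (R : nzRingType).

(* [msize p] is deg p + 1, and 0 for p = 0. *)
Definition degle_pred : pred {mpoly R[m]} := fun p => (msize p <= r.+1)%N.

Lemma degleP (p : {mpoly R[m]}) :
  reflect (forall u : 'X_{1..m}, (r < mdeg u)%N -> p@_u = 0) (degle_pred p).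
Proof.
apply: (iffP idP) => [ler u ltu|h].
  by apply: memN_msupp_eq0; apply: contraL ltu => /msize_mdeg_lt lt;
     rewrite -leqNgt -ltnS (leq_trans lt ler).
rewrite /degle_pred msizeE big_seq.
elim/big_ind: _ => // [x y lx ly|u u_in]; first by rewrite geq_max lx ly.
rewrite ltnS leqNgt; apply/negP => /h /eqP.
by rewrite mcoeff_eq0 u_in.
Qed.

Fact degle_submod_closed : submod_closed degle_pred.
Proof.
split=> [|c p q /degleP hp /degleP hq]; first by rewrite unfold_in /degle_pred msize0.
by apply/degleP => u hu; rewrite mcoeffD mcoeffZ hp // hq // mulr0 addr0.
Qed.

HB.instance Definition _ :=
  GRing.isSubmodClosed.Build R {mpoly R[m]} degle_pred degle_submod_closed.

(* V_{m,r} as a finite-dimensional space: {mpoly R[m]} itself is not a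
   [vectType], so its subspaces have no [\dim]. *)
Record degle_mpoly :=
  DegleMPoly { mpoly_of_degle :> {mpoly R[m]}; _ : degle_pred mpoly_of_degle }.

HB.instance Definition _ := [isSub for mpoly_of_degle].
HB.instance Definition _ := [Choice of degle_mpoly by <:].
HB.instance Definition _ := [SubChoice_isSubLmodule of degle_mpoly by <:].

Lemma degle_vecaxiom : vector_axiom #|{: 'X_{1..m < r.+1}}| degle_mpoly.
Proof.
pose N := #|{: 'X_{1..m < r.+1}}|.
pose mon (j : 'I_N) : 'X_{1..m} := enum_val j : 'X_{1..m < r.+1}.
pose coefs (p : degle_mpoly) : 'rV[R]_N := \row_j (val p)@_(mon j).
pose poly_of (v : 'rV[R]_N) : {mpoly R[m]} := \sum_j v 0 j *: 'X_[mon j].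
have mon_inj : injective mon by move=> i j /val_inj /enum_val_inj.
have poly_of_le v : degle_pred (poly_of v).
  apply/degleP => u hu; rewrite /poly_of raddf_sum /= big1 // => j _.
  rewrite mcoeffZ mcoeffX; case: eqP => [e|_]; last by rewrite mulr0.
  by move: (bmdeg (enum_val j)); rewrite -/(mon j) e ltnS leqNgt hu.
exists coefs.
  by move=> c p q; apply/rowP => j; rewrite !mxE /= mcoeffD mcoeffZ.
exists (fun v => DegleMPoly (poly_of_le v)) => [p|v].
  apply/val_inj/mpolyP => u /=; rewrite /poly_of raddf_sum /=.
  have [ltu|gtu] := ltnP (mdeg u) r.+1; last first.
    rewrite (degleP _ (valP p) u gtu) big1 // => j _.
    rewrite mcoeffZ mcoeffX; case: eqP => [e|_]; last by rewrite mulr0.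
    by move: (bmdeg (enum_val j)); rewrite -/(mon j) e ltnNge gtu.
  pose j0 : 'I_N := enum_rank (BMultinom ltu).
  have monj0 : mon j0 = u by rewrite /mon /j0 enum_rankK.
  rewrite (bigD1 j0) //= big1 ?addr0 => [|j nj].
    by rewrite mcoeffZ mcoeffX mxE monj0 eqxx mulr1.
  rewrite mcoeffZ mcoeffX -monj0 (inj_eq mon_inj) (negPf nj) mulr0 //.
apply/rowP => j; rewrite mxE /= /poly_of raddf_sum /= (bigD1 j) //= big1.
  by rewrite mcoeffZ mcoeffX eqxx mulr1 addr0.
by move=> i ni; rewrite mcoeffZ mcoeffX (inj_eq mon_inj) (negPf ni) mulr0.
Qed.

HB.instance Definition _ :=
  Lmodule_hasFinDim.Build R degle_mpoly degle_vecaxiom.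

End BoundedDegree.

Definition Nq (m : nat) (F : finFieldType) (g : {mpoly F[m]}) : nat :=
  #|[set a : {ffun 'I_m -> F} | g.@[a] == 0]|.

(* The condition 0 < k i only matters when #|F| = 2: otherwise it follows from
   coprimality. For #|F| = 2, k i = 0 would let the constant monomial stand for
   a power of 'X_i, which is not intended (with V the constants, m = 2 and
   L = {0}, the upper bound would read 4 <= 3). *)
Definition property_star (m r : nat) (F : finFieldType)
    (V : {vspace degle_mpoly m r F}) : Prop :=
  exists I : {fset 'X_{1..m}},
    [/\ exists2 b : seq (degle_mpoly m r F), basis_of V b &
          [seq mpoly_of_degle p | p <- b] = [seq 'X_[i] | i <- I],
        0%MM \in I &
        exists k : 'I_m -> nat, forall i : 'I_m,
          [/\ (0 < k i)%N, (U_(i) *+ k i)%MM \in I & coprime (k i) #|F|.-1]].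

(* Main.v *)
Require Import Defs.
From mathcomp Require Import all_boot all_order all_algebra all_field finmap.
From mathcomp.multinomials Require Import mpoly.

(** For an evaluation point [a], let [T a] be the number of pairs of [L] that
    agree at [a]; the sum to be bounded is [\sum_a T a]. Cauchy-Schwarz over the
    values gives [q * T a >= |L|^2], hence the lower bound. More generally put
    [D l := q * T l - |L|^2 >= 0] for every linear form [l] on [V]. A nonzero
    vector is killed by a proportion [1/q] of the forms, so summing over the
    whole dual space gives [\sum_l D l = (q - 1) * q^(dim V) * |L|]. By property
    (star) distinct points have distinct evaluations, and these take the value 1
    at the polynomial 1, so their nonzero multiples are pairwise distinct. As [D]
    is invariant under nonzero scaling,
    [(q - 1) * \sum_a D a <= \sum_l D l], which is the upper bound. *)

Set Implicit Arguments.
Unset Strict Implicit.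
Unset Printing Implicit Defensive.

Import GRing.Theory.

Local Open Scope ring_scope.

(** Sum [2 * A i * A j <= A i ^ 2 + A j ^ 2] over all pairs [(i, j)]. *)
Lemma sum_nat_Cauchy (K : finType) (A : K -> nat) :
  ((\sum_t A t) ^ 2 <= #|K| * \sum_t A t ^ 2)%N.
Proof.
rewrite -(leq_pmul2l (isT : 0 < 2)%N) -{1}mulnn big_distrlr /= big_distrr /=.
have -> : (2 * (#|K| * \sum_t A t ^ 2) = \sum_i \sum_j (A i ^ 2 + A j ^ 2))%N.
  under [RHS]eq_bigr do rewrite big_split /= sum_nat_const.
  by rewrite big_split /= -big_distrr /= sum_nat_const mul2n addnn.
apply: leq_sum => i _; rewrite big_distrr /=.
by apply: leq_sum => j _; rewrite nat_Cauchy.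
Qed.

(** Cauchy-Schwarz for the fibre sizes [A t] of [x]: they add up to [size s], and their squares
    count the colliding pairs. *)
Lemma collisions_ge (T : Type) (K : finType) (s : seq T) (x : T -> K) :
  (size s ^ 2 <= #|K| * \sum_(u <- s) \sum_(v <- s) (x u == x v))%N.
Proof.
pose A t := (\sum_(u <- s) (x u == t))%N.
have sumA : (\sum_t A t = size s)%N.
  rewrite exchange_big /= -sum1_size; apply: eq_bigr => u _.
  rewrite (bigD1 (x u)) //= eqxx big1 // => t /negPf.
  by rewrite eq_sym => ->.
have -> : (\sum_(u <- s) \sum_(v <- s) (x u == x v) = \sum_t A t ^ 2)%N.
  under [RHS]eq_bigr do rewrite -mulnn big_distrlr /=.
  rewrite [RHS]exchange_big /=; apply: eq_bigr => u _.
  rewrite [RHS]exchange_big /=; apply: eq_bigr => v _.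
  rewrite (bigD1 (x u)) //= eqxx mul1n eq_sym big1 ?addn0 // => t /negPf.
  by rewrite eq_sym => ->.
by rewrite -sumA sum_nat_Cauchy.
Qed.

Lemma card_annihilator (F : finFieldType) (n : nat) (w : 'rV[F]_n) :
  w != 0 -> (#|F| * \sum_(l : 'cV[F]_n) (w *m l == 0)%R = #|F| ^ n)%N.
Proof.
case/rV0Pn => i wi0.
(* As [w *m z] is 1, translation by [z *m t] carries the kernel of [w] onto the fibre over [t]; so
   the [q] fibres have equal size. *)
pose z : 'cV[F]_n := (w 0 i)^-1 *: delta_mx i 0.
have wz : w *m z = 1%:M.
  by apply/matrixP => j k; rewrite !ord1 -scalemxAr -colE !mxE mulVf.
have fibre (t : 'M[F]_1) :
    (\sum_(l : 'cV[F]_n) (w *m l == t) = \sum_(l : 'cV[F]_n) (w *m l == 0)%R)%N.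
  rewrite (reindex_inj (addrI (z *m t))) /=; apply: eq_bigr => l _.
  by rewrite mulmxDr mulmxA wz mul1mx -subr_eq0 addrC addKr.
transitivity (\sum_(t : 'M[F]_1) \sum_(l : 'cV[F]_n) (w *m l == t))%N.
  by under [RHS]eq_bigr do rewrite fibre; rewrite sum_nat_const card_mx muln1.
rewrite exchange_big /=.
transitivity (\sum_(l : 'cV[F]_n) 1)%N.
  apply: eq_bigr => l _; rewrite (bigD1 (w *m l)) //= eqxx big1 // => t /negPf.
  by rewrite eq_sym => ->.
by rewrite sum1_card card_mx muln1.
Qed.

(** Vectors are rows of coordinates and linear forms are columns, so [u *m l] is the value of the
    form [l] at [u]. *)
Definition collisions (F : finFieldType) (n : nat) (s : seq 'rV[F]_n)
    (l : 'cV[F]_n) : nat :=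
  (\sum_(u <- s) \sum_(v <- s) (u *m l == v *m l))%N.

Lemma collisionsZ (F : finFieldType) (n : nat) (s : seq 'rV[F]_n)
    (c : F) (l : 'cV[F]_n) :
  c != 0 -> collisions s (c *: l) = collisions s l.
Proof.
move=> c0; apply: eq_bigr => u _; apply: eq_bigr => v _.
by rewrite -!scalemxAr (inj_eq (scalerI c0)).
Qed.

Lemma collisions_ge_sqr (F : finFieldType) (n : nat) (s : seq 'rV[F]_n)
    (l : 'cV[F]_n) : (size s ^ 2 <= #|F| * collisions s l)%N.
Proof.
by have := collisions_ge s (fun u => u *m l); rewrite card_mx muln1.
Qed.

(** A pair [(u, v)] collides under every form if [u = v], and otherwise under those annihilating
    [u - v]. The factor [#|F|] avoids division. *)
Lemma sum_collisions (F : finFieldType) (n : nat) (s : seq 'rV[F]_n) :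
  uniq s ->
  (#|F| * \sum_l collisions s l
     = #|F| ^ n * size s ^ 2 + #|F|.-1 * (#|F| ^ n * size s))%N.
Proof.
move=> us.
have q0 : (0 < #|F|)%N by apply/card_gt0P; exists 0.
have pair (u v : 'rV[F]_n) : (#|F| * \sum_(l : 'cV[F]_n) (u *m l == v *m l)
    = #|F| ^ n + #|F|.-1 * #|F| ^ n * (u == v))%N.
  have [->|nuv] := eqVneq u v.
    under eq_bigr do rewrite eqxx.
    by rewrite sum1_card card_mx !muln1 -mulSn prednK.
  rewrite muln0 addn0 -(@card_annihilator _ _ (u - v)) ?subr_eq0 //.
  by congr (_ * _)%N; apply: eq_bigr => l _; rewrite mulmxBl subr_eq0.
rewrite exchange_big /= big_distrr /=.
transitivity (\sum_(u <- s) (size s * #|F| ^ n + #|F|.-1 * #|F| ^ n))%N.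
  apply: eq_big_seq => u us_u.
  rewrite exchange_big big_distrr /=.
  under eq_bigr do rewrite pair.
  rewrite big_split /= -big_distrr /= big_const_seq count_predT iter_addn_0.
  rewrite mulnC; congr (_ + _)%N.
  rewrite (bigD1_seq u) //= eqxx big1 ?addn0 ?muln1 // => v /negPf.
  by rewrite eq_sym => ->.
rewrite big_const_seq count_predT iter_addn_0 mulnDl mulnA.
by rewrite [X in (X * _)%N]mulnC -mulnA mulnn.
Qed.

Lemma sum_collisions_le (F : finFieldType) (n : nat) (s : seq 'rV[F]_n)
    (P : finType) (e : P -> 'cV[F]_n) (i0 : 'I_n) :
  uniq s -> injective e -> (forall a, e a i0 0 = 1) ->
  (#|F| * \sum_a collisions s (e a) <= #|P| * size s ^ 2 + #|F| ^ n * size s)%N.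
Proof.
move=> us e_inj e1.
have q1 : (0 < #|F|.-1)%N by rewrite -ltnS prednK ?finNzRing_gt1 // ltnW ?finNzRing_gt1.
pose D l := (#|F| * collisions s l - size s ^ 2)%N.
have DE l : (#|F| * collisions s l = size s ^ 2 + D l)%N.
  by rewrite subnKC // collisions_ge_sqr.
have sumD : (\sum_l D l = #|F|.-1 * (#|F| ^ n * size s))%N.
  have := sum_collisions us; rewrite big_distrr /=.
  under eq_bigr do rewrite DE.
  rewrite big_split /= sum_nat_const card_mx muln1.
  exact: addnI.
rewrite big_distrr /=; under eq_bigr do rewrite DE.
rewrite big_split /= sum_nat_const leq_add2l -(leq_pmul2l q1) -sumD.
pose h (x : F * P) := x.1 *: e x.2.
pose B := [set x : F * P | x.1 != 0].
have h_inj : {in B &, injective h}.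
  move=> [c a] [c' a']; rewrite !inE /= => c0 _ hE.
  (* Entry [i0] of [c *: e a] is [c], so the scalar can be read off. *)
  have cc : c = c'.
    by have := congr1 (fun l : 'cV[F]_n => l i0 0) hE; rewrite /h !mxE !e1 !mulr1.
  by rewrite -cc in hE *; congr (_, _); exact: e_inj (scalerI c0 hE).
have -> : (#|F|.-1 * \sum_a D (e a) = \sum_(x in B) D (h x))%N.
  rewrite -(cardC1 (0 : F)) -sum_nat_const pair_big /=.
  apply: eq_big => [[c a]|[c a]]; rewrite ?inE ?andbT //= => c0.
  by rewrite /D collisionsZ.
(* Forms outside the image of [h] only add nonnegative terms. *)
rewrite -(big_imset _ h_inj) /= [leqRHS](bigID (mem (h @: B))) /=.
exact: leq_addr.
Qed.

(** Bezout gives [u * k = v * (q - 1) + 1], so raising to the power [u] inverts the map. Iterating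
    [x ^+ q = x] covers [x = 0] as well. *)
Lemma expf_coprime_inj (F : finFieldType) (k : nat) :
  (0 < k)%N -> coprime k #|F|.-1 -> injective (fun x : F => x ^+ k).
Proof.
move=> k0; case: (egcdnP #|F|.-1 k0) => u v bez _ /eqP cop.
have q0 : (0 < #|F|)%N by apply/card_gt0P; exists 0.
have expK (x : F) : (x ^+ k) ^+ u = x.
  rewrite -exprM mulnC bez cop; elim: v {bez} => [|v IHv]; first by rewrite expr1.
  by rewrite mulSn -addnA exprD IHv -exprSr prednK // expf_card.
exact: (can_inj (g := fun y => y ^+ u)) expK.
Qed.

Theorem theorem1p6 (F : finFieldType) (m r : nat) (hm : (1 <= m)%N) (hr : (1 <= r)%N)
    (V : {vspace degle_mpoly m r F}) (hV : property_star V)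
    (L : {fset degle_mpoly m r F}) (hL : forall f, f \in L -> f \in V) :
  (#|F| ^ (m - 1) * #|` L| ^ 2
     <= \sum_(f <- L) \sum_(f' <- L) Nq (f - f')%R
     <= #|F| ^ (m - 1) * #|` L| ^ 2 + #|F| ^ (\dim V - 1) * #|` L|)%N.
Proof.
case: hV => I [[b bV bI] I0 [k hk]].
have q0 : (0 < #|F|)%N by apply/card_gt0P; exists 0.
pose n := size b; pose bt : n.-tuple _ := in_tuple b.
have bVt : basis_of V bt by [].
have dimV : \dim V = n by exact: vector.size_basis bVt.
pose P := {ffun 'I_m -> F}.
have cardP : #|{: P}| = (#|F| ^ m)%N by rewrite card_ffun card_ord.
have idx i : i \in I -> exists j : 'I_n, mpoly_of_degle b`_j = 'X_[i].
  move=> iI; have : 'X_[F, i] \in [seq mpoly_of_degle p | p <- b].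
    by rewrite bI map_f.
  case/(nthP 0) => j; rewrite size_map => jn <-.
  by exists (Ordinal jn); rewrite (nth_map 0).
(* The constant monomial: its evaluations are all 1, and its presence in [b] makes [n - 1] a genuine
   subtraction. *)
have [i0 bi0] := idx _ I0.
have n0 : (0 < n)%N by case: (i0) => j; apply: leq_trans.
have NqE : (\sum_(f <- L) \sum_(f' <- L) Nq (f - f')%R
    = \sum_(a : P) \sum_(f <- L) \sum_(f' <- L) (f.@[a] == f'.@[a]))%N.
  rewrite [RHS]exchange_big /=; apply: eq_bigr => f _.
  rewrite [RHS]exchange_big /=; apply: eq_bigr => f' _.
  rewrite /Nq -sum1_card big_mkcond /=; apply: eq_bigr => a _.
  by rewrite inE mevalB subr_eq0; case: (_ == _).
apply/andP; rewrite NqE; split.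
  rewrite -(leq_pmul2l q0) mulnA -expnS subn1 prednK // big_distrr /=.
  rewrite -cardP -sum_nat_const.
  by apply: leq_sum => a _; exact: collisions_ge.
pose crd (f : degle_mpoly m r F) : 'rV[F]_n := \row_j coord bt j f.
(* Evaluation at [a], as a form on [V] in the basis [b]. *)
pose e (a : P) : 'cV[F]_n := \col_j (mpoly_of_degle b`_j).@[a].
have crdE f a : f \in V -> crd f *m e a = (f.@[a])%:M.
  move=> fV; apply/matrixP => x y; rewrite !ord1 !mxE eqxx mulr1n.
  rewrite [in RHS](coord_basis bVt fV) -[mpoly_of_degle _]/(val _) !raddf_sum /=.
  by apply: eq_bigr => j _; rewrite !mxE /= mevalZ.
have crd_inj : {in L &, injective crd}.
  move=> f g /hL fV /hL gV fg.
  rewrite (coord_basis bVt fV) (coord_basis bVt gV); apply: eq_bigr => j _.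
  by have := congr1 (fun u : 'rV[F]_n => u 0 j) fg; rewrite !mxE => ->.
(* The entry of [e a] at the monomial [U_(i) *+ k i] is [a i ^+ k i], which determines [a i]. *)
have e_inj : injective e.
  move=> a a' aa; apply/ffunP => i; have [ki0 kI cop] := hk i.
  have [j bj] := idx _ kI.
  have := congr1 (fun l : 'cV[F]_n => l j 0) aa; rewrite !mxE bj.
  rewrite -mpolyXn !rmorphXn /= !mevalXU.
  exact: expf_coprime_inj ki0 cop _ _.
have e1 a : e a i0 0 = 1 by rewrite mxE bi0 mpolyX0 meval1.
have us : uniq [seq crd f | f <- L] by rewrite (map_inj_in_uniq crd_inj) fset_uniq.
have := sum_collisions_le us e_inj e1.
rewrite cardP size_map.
have -> : (\sum_a collisions [seq crd f | f <- L] (e a)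
    = \sum_(a : P) \sum_(f <- L) \sum_(f' <- L) (f.@[a] == f'.@[a]))%N.
  apply: eq_bigr => a _; rewrite /collisions big_map.
  apply: eq_big_seq => f /hL fV; rewrite big_map.
  apply: eq_big_seq => f' /hL fV'; rewrite !crdE //.
  rewrite (inj_eq (f := scalar_mx)) // => x y /(congr1 (fun A : 'M_1 => A 0 0)).
  by rewrite !mxE.
move=> le.
by rewrite -(leq_pmul2l q0) mulnDr !(mulnA #|F|) -!expnS !subn1 !prednK ?dimV.
Qed.
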